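(* Let $A$ be a Banach algebra of type $(M^+)$ and $m\in A^{**}$. Then the following statements are equivalent: (i) $m\in A$. (ii) $m\cdot A\subseteq A$ and $m\in Z_t^{(l)}(A^{**})$. (iii) $m\cdot A\subseteq A$ and $m\bigtriangleup E=m$ for all $E\in\mathcal{E}$. (iv) $A\cdot m\subseteq A$ and $E\cdot m=m$ for all $E\in\mathcal{E}$. (v) $A\cdot m\subseteq A$ and $m\in Z_t^{(r)}(A^{**})$.
   Context: Notation for a Banach algebra $A$. BAI means bounded (two-sided) approximate identity; WSC means weakly sequentially complete. $A^*$ is an $A$-bimodule via $\langle f\cdot a,b\rangle=\langle f,ab\rangle$, $\langle a\cdot f,b\rangle=\langle f,ba\rangle$; $A^*A=\{f\cdot a\}$, $AA^*=\{a\cdot f\}$. $A$ is identified with its canonical image in $A^{**}$. Left Arens product on $A^{**}$: $\langle m\cdot n,f\rangle=\langle m,n\cdot f\rangle$, $\langle n\cdot f,a\rangle=\langle n,f\cdot a\rangle$. Right Arens product: $\langle m\bigtriangleup n,f\rangle=\langle n,f\bigtriangleup m\rangle$, $\langle f\bigtriangleup m,a\rangle=\langle m,a\cdot f\rangle$. $Z_t^{(l)}(A^{**})$ is the set of $m\in A^{**}$ such that $n\mapsto m\cdot n$ is weak$^*$-weak$^*$ continuous on $A^{**}$; $Z_t^{(r)}(A^{**})$ is the set of $m$ such that $n\mapsto n\bigtriangleup m$ is weak$^*$-weak$^*$ continuous. $\mathcal{E}=\{E\in A^{**}:n\cdot E=E\bigtriangleup n=n\ \forall n\in A^{**}\}$.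 Types. $LM(A)=\{T\in B(A):T(ab)=T(a)b\}$, $RM(A)=\{T\in B(A):T(ab)=aT(b)\}$. For $\mu\in LM(A)$ (resp. $RM(A)$), ''$\mu\in A$'' means $\mu$ is left (resp. right) multiplication by some element of $A$; for a closed subalgebra $C$ with $\mu(C)\subseteq C$, ''$\mu|_C\in C$'' means $\mu|_C$ is left (resp. right) multiplication on $C$ by an element of $C$. A Banach algebra $A$ with a BAI is of type $(LM^+)$ (resp. $(RM^+)$) if for every $\mu\in LM(A)$ (resp. $\mu\in RM(A)$) there are a closed subalgebra $B$ of $A$ with a BAI and a family $\{B_i\}$ of closed two-sided ideals of $B$ such that: (I) each $B_i$ is WSC with a sequential BAI; (II) for each $i$ there is a bounded linear $B$-bimodule projection $p_i$ from $B$ onto $B_i$; (III) for any $\nu\in LM(B)$ (resp. $RM(B)$), if $\nu|_{B_i}\in B_i$ for all $i$, then $\nu\in B$; (1) $f|_B\in B^*B$ for each $f\in A^*A$ (resp. $f|_B\in BB^*$ for each $f\in AA^*$); (2) $\mu(B)\subseteq B$, and $\mu\in A$ if $\mu|_B\in B$; (3) any BAI of $B$ is a BAI of $A$. $A$ is of type $(M^+)$ if it is of type $(LM^+)$ and of type $(RM^+)$. *)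

(* Defs.v *)
From HB Require Import structures.
From mathcomp Require Import all_boot all_order all_algebra.
From mathcomp Require Import complex.
From mathcomp Require Import all_classical all_reals all_analysis.

Set Implicit Arguments.
Unset Strict Implicit.
Unset Printing Implicit Defensive.

Import Order.TTheory GRing.Theory Num.Theory.
Import numFieldNormedType.Exports.

Local Open Scope classical_set_scope.
Local Open Scope ring_scope.
Local Open Scope complex_scope.

(* Normed spaces are over the complex field [R[i]], [R] being the real line. *)
Section Dual.
Variables (R : realType) (V : normedModType R[i]).

Definition functional : {pred (V -> R[i]^o)} :=
  fun f : V -> R[i]^o => `[< linear f /\ continuous f >].

Lemma functionalP (f : V -> R[i]^o) :
  reflect (linear f /\ continuous f) (f \in functional).
Proof. exact: asboolP. Qed.

Lemma functional_submod_closed : submod_closed functional.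
Proof.
split.
  apply/functionalP; split=> [a x y|]; last exact: cst_continuous.
  by rewrite /= scaler0 addr0.
move=> a f g /functionalP[lf cf] /functionalP[lg cg]; apply/functionalP; split.
  move=> b x y; rewrite !fctE lf lg !scalerDr scalerA mulrC -scalerA.
  by rewrite addrACA.
move=> x; apply: cvgD; [apply: cvgZl_tmp; exact: cf|exact: cg].
Qed.

HB.instance Definition _ :=
  GRing.isSubmodClosed.Build _ _ functional functional_submod_closed.

Record tdual := Dual { dual_fun :> V -> R[i]^o; _ : dual_fun \in functional }.

HB.instance Definition _ := [isSub for dual_fun].
HB.instance Definition _ := [Choice of tdual by <:].
HB.instance Definition _ := [SubChoice_isSubLmodule of tdual by <:].

Lemma dualP (f g : tdual) : (forall x, f x = g x) -> f = g.
Proof. by move=> fg; apply/val_inj/funext. Qed.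

Lemma dual_linear (f : tdual) : linear f.
Proof. by case: f => f /= /functionalP[]. Qed.

HB.instance Definition _ (f : tdual) :=
  GRing.isLinear.Build _ _ _ _ (dual_fun f) (dual_linear f).

Lemma dual_continuous (f : tdual) : continuous f.
Proof. by case: f => f /= /functionalP[]. Qed.

Lemma dual_bounded (f : tdual) : exists M, forall x, `|f x| <= M * `|x|.
Proof.
have /linear_bounded_continuous/linear_boundedP := @dual_continuous f.
move=> H. 
near (pinfty_nbhs (R[i])) => M.
by exists M; near: M.
Unshelve. all: by end_near. Qed.

(* The norms of normed spaces over [R[i]] are [R[i]]-valued, while suprema are
   taken in [R]. *)
Definition dual_norm (f : tdual) : R[i] :=
  (sup [set complex.Re `|f x| | x in [set x | `|x| <= 1]])%:C.

Lemma dual_norm_has_sup (f : tdual) :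
  has_sup [set complex.Re `|f x| | x in [set x | `|x| <= 1]].
Proof.
split; first by exists (complex.Re `|f 0|); exists 0 => //=; rewrite normr0.
have [M fM] := dual_bounded f.
exists (complex.Re `|M|) => _ [x /= x1 <-].
suff : `|f x| <= `|M| by rewrite lecE => /andP[].
apply: le_trans (fM x) _; have := normr_ge0 x => x0.
have [->|x_neq0] := eqVneq `|x| 0; first by rewrite mulr0.
have Mge0 : 0 <= M.
  have := le_trans (normr_ge0 _) (fM x).
  by rewrite pmulr_lge0 // lt_def x_neq0.
by rewrite (ger0_norm Mge0) ler_piMr.
Qed.

Lemma normC_Re (W : normedModType R[i]) (x : W) : `|x| = (complex.Re `|x|)%:C.
Proof. by rewrite RRe_real // normr_real. Qed.

Lemma dual_norm_ge0 (f : tdual) : 0 <= dual_norm f.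
Proof.
have [_ ub] := dual_norm_has_sup f.
rewrite /dual_norm lecR -[0]/(complex.Re 0) -[X in complex.Re X](normr0 R[i]^o).
rewrite -(linear0 f); apply: ub_le_sup => //.
by exists 0 => //=; rewrite normr0.
Qed.

Lemma le_dual_norm_ball (f : tdual) x : `|x| <= 1 -> `|f x| <= dual_norm f.
Proof.
move=> x1; rewrite (normC_Re (f x : R[i]^o)) lecR.
by apply: ub_le_sup; [have [] := dual_norm_has_sup f|exists x].
Qed.

Lemma le_dual_norm (f : tdual) x : `|f x| <= dual_norm f * `|x|.
Proof.
have [->|x0] := eqVneq x 0; first by rewrite linear0 !normr0 mulr0.
have nx0 : 0 < `|x| by rewrite normr_gt0.
rewrite -ler_pdivrMr // mulrC -[X in X * _](@gtr0_norm _ (`|x|^-1)); last first.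
  by rewrite invr_gt0.
rewrite -normrM -[_ * _]/(`|x|^-1 *: f x) -linearZ le_dual_norm_ball //.
by rewrite normrZ gtr0_norm ?invr_gt0 // mulVf ?gt_eqF.
Qed.

Lemma dual_norm_le (f : tdual) M :
  0 <= M -> (forall x, `|f x| <= M * `|x|) -> dual_norm f <= M.
Proof.
move=> M0 fM; have -> : M = (complex.Re M)%:C by rewrite RRe_real // ger0_real.
rewrite /dual_norm lecR; apply: ge_sup; first by have [] := dual_norm_has_sup f.
move=> _ [x /= x1 <-].
suff : `|f x| <= M by rewrite lecE => /andP[].
by apply: le_trans (fM x) _; rewrite ler_piMr.
Qed.

Lemma dual_norm_triangle (f g : tdual) :
  dual_norm (f + g) <= dual_norm f + dual_norm g.
Proof.
apply: dual_norm_le => [|x]; first by rewrite addr_ge0 // dual_norm_ge0.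
by rewrite mulrDl (le_trans (ler_normD _ _)) // lerD // le_dual_norm.
Qed.

Lemma dual_normZ_le a (f : tdual) : dual_norm (a *: f) <= `|a| * dual_norm f.
Proof.
apply: dual_norm_le => [|x]; first by rewrite mulr_ge0 // dual_norm_ge0.
by rewrite -mulrA (normrM a (f x)) ler_wpM2l // le_dual_norm.
Qed.

Lemma dual_normZ a (f : tdual) : dual_norm (a *: f) = `|a| * dual_norm f.
Proof.
apply/eqP; rewrite eq_le dual_normZ_le /=.
have [->|a0] := eqVneq a 0; first by rewrite normr0 mul0r dual_norm_ge0.
rewrite -ler_pdivlMl ?normr_gt0 // -normfV.
by rewrite -[X in dual_norm X <= _](scalerK a0) dual_normZ_le.
Qed.

Lemma dual_norm0_eq0 (f : tdual) : dual_norm f = 0 -> f = 0.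
Proof.
move=> f0; apply: dualP => x; apply/eqP; rewrite -normr_le0.
by rewrite (le_trans (le_dual_norm f x)) // f0 mul0r.
Qed.

HB.instance Definition _ := Lmodule_isNormed.Build R[i] tdual
  dual_norm_triangle dual_normZ dual_norm0_eq0.

Lemma ler_dualM (f : tdual) x : `|f x| <= `|f| * `|x|.
Proof. exact: le_dual_norm. Qed.

(* The weak-star topology: the initial topology for evaluations at points. *)
Definition weak_star :=
  initial_topology (dual_fun : tdual -> {ptws V -> R[i]^o}).

HB.instance Definition _ := Uniform.on weak_star.

Lemma weak_star_cvgP (F : set_system weak_star) (f : weak_star) : Filter F ->
  F --> f <-> forall x : V, (g : tdual) x @[g --> F] --> (f : tdual) x.
Proof.
move=> FF; pose D : weak_star -> {ptws V -> R[i]^o} := dual_fun.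
have DF : F --> f <-> D @ F --> D f.
  split=> [Ff|DFf A [_ [[B oB <-] Bf BA]]].
    by apply: continuous_cvg Ff; exact: initial_continuous.
  by apply: filterS BA _; apply: DFf; exact: open_nbhs_nbhs.
rewrite DF; exact: (@pointwise_cvgP _ _ (D @ F) (D f)).
Qed.

Lemma bounded_functional (f : V -> R[i]^o) M :
  linear f -> (forall x, `|f x| <= M * `|x|) -> f \in functional.
Proof.
move=> lf fM; apply/functionalP; split=> //.
pose L := GRing.isLinear.Build _ _ _ _ f lf.
pose F : {linear V -> R[i]^o} := HB.pack f L.
have : continuous F; last by [].
apply/linear_bounded_continuous/linear_boundedP.
near=> r => x; apply: le_trans (fM x) _.
have [->|x0] := eqVneq x 0; first by rewrite normr0 !mulr0.
have Mge0 : 0 <= M.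
  have := le_trans (normr_ge0 _) (fM x).
  by rewrite pmulr_lge0 // normr_gt0.
rewrite ler_wpM2r // -(ger0_norm Mge0).
by near: r; apply: nbhs_pinfty_ge; rewrite normr_real.
Unshelve. all: by end_near. Qed.

End Dual.

Section CanonicalEmbedding.
Variables (R : realType) (V : normedModType R[i]).

Fact bidual_inj_functional (a : V) :
  (fun f : tdual V => f a) \in @functional R (tdual V).
Proof.
apply: (@bounded_functional _ _ _ `|a|) => [c f g //|f].
by rewrite mulrC le_dual_norm.
Qed.
Definition bidual_inj (a : V) : tdual (tdual V) := Dual (bidual_inj_functional a).

Definition weakly_cauchy (u : V^nat) :=
  forall f : tdual V, cauchy ((fun n => f (u n)) @ \oo).

Definition weakly_cvg (u : V^nat) (x : V) :=
  forall f : tdual V, (fun n => f (u n)) @ \oo --> f x.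

Definition weakly_sequentially_complete :=
  forall u : V^nat, weakly_cauchy u -> exists x, weakly_cvg u x.

End CanonicalEmbedding.

(* Not assumed to be unital. *)
HB.mixin Record isBanachAlgebra (K : numFieldType) A
    & CompleteNormedModule K A := {
  bmul : A -> A -> A;
  bmulA : associative bmul;
  bmulDl : left_distributive bmul +%R;
  bmulDr : right_distributive bmul +%R;
  bmulZl : forall (k : K) (a b : A), bmul (k *: a) b = k *: bmul a b;
  bmulZr : forall (k : K) (a b : A), bmul a (k *: b) = k *: bmul a b;
  ler_normbM : forall a b : A, `|bmul a b| <= `|a| * `|b|
}.

#[short(type="banachAlgType")]
HB.structure Definition BanachAlgebra (K : numFieldType) :=
  {A of CompleteNormedModule K A & isBanachAlgebra K A}.

Notation "a ** b" := (bmul a b) (at level 40, left associativity).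

Section Subalgebra.
Variables (R : realType) (A : banachAlgType R[i]).

Record closed_subalgebra := ClosedSubalgebra {
  subalgebra_set :> set A;
  subalgebra_closed : closed subalgebra_set;
  subalgebra0 : subalgebra_set 0;
  subalgebraZD : forall (k : R[i]) (a b : A),
    subalgebra_set a -> subalgebra_set b -> subalgebra_set (k *: a + b);
  subalgebraM : forall a b : A,
    subalgebra_set a -> subalgebra_set b -> subalgebra_set (a ** b) }.

Variable S : closed_subalgebra.

Definition subalgebra_pred : {pred A} := fun a => `[< subalgebra_set S a >].

Lemma subalgebra_submod_closed : submod_closed subalgebra_pred.
Proof.
split=> [|k a b /asboolP Sa /asboolP Sb]; apply/asboolP.
  exact: subalgebra0.
exact: subalgebraZD.
Qed.

HB.instance Definition _ :=
  GRing.isSubmodClosed.Build _ _ subalgebra_pred subalgebra_submod_closed.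

Record subalgebra := Subalgebra {
  subalgebra_val :> A; _ : subalgebra_val \in subalgebra_pred }.

HB.instance Definition _ := [isSub for subalgebra_val].
HB.instance Definition _ := [Choice of subalgebra by <:].
HB.instance Definition _ := [SubChoice_isSubLmodule of subalgebra by <:].

Definition subalgebra_norm (a : subalgebra) : R[i] := `|val a|.

Fact subalgebra_norm_triangle a b :
  subalgebra_norm (a + b) <= subalgebra_norm a + subalgebra_norm b.
Proof. exact: ler_normD. Qed.

Fact subalgebra_normZ k a : subalgebra_norm (k *: a) = `|k| * subalgebra_norm a.
Proof. exact: normrZ. Qed.

Fact subalgebra_norm0_eq0 a : subalgebra_norm a = 0 -> a = 0.
Proof. by move=> /normr0_eq0 a0; apply: val_inj. Qed.

HB.instance Definition _ := Lmodule_isNormed.Build R[i] subalgebra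
  subalgebra_norm_triangle subalgebra_normZ subalgebra_norm0_eq0.

Lemma subalgebraP (a : subalgebra) : subalgebra_set S a.
Proof. by case: a => a /= /asboolP. Qed.

Fact subalgebra_complete (F : set_system subalgebra) :
  ProperFilter F -> cauchy F -> cvg F.
Proof.
move=> FF /cauchyP Fc.
have /cauchy_cvg/cvg_ex[l Fl] : cauchy ((subalgebra_val : subalgebra -> A) @ F).
  apply: cauchy_exP => e e0; have [a Fa] := Fc e e0; exists (val a).
  by move: Fa; rewrite -!ball_normE.
have Sl : l \in subalgebra_pred.
  apply/asboolP; apply: (closed_cvg (subalgebra_set S) _ _ l Fl).
    exact: subalgebra_closed.
  by near=> x; exact: subalgebraP.
apply/cvg_ex; exists (Subalgebra Sl); apply/cvgrPdist_lt => e e0.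
by move/cvgrPdist_lt : Fl => /(_ e e0).
Unshelve. all: by end_near. Qed.

HB.instance Definition _ := Uniform_isComplete.Build subalgebra
  subalgebra_complete.

Fact subalgebra_bmul_subproof (a b : subalgebra) :
  val a ** val b \in subalgebra_pred.
Proof. by apply/asboolP; apply: subalgebraM; exact: subalgebraP. Qed.

Definition subalgebra_bmul (a b : subalgebra) : subalgebra :=
  Subalgebra (subalgebra_bmul_subproof a b).

Fact subalgebra_bmulA : associative subalgebra_bmul.
Proof. by move=> a b c; apply: val_inj; exact: bmulA. Qed.

Fact subalgebra_bmulDl : left_distributive subalgebra_bmul +%R.
Proof. by move=> a b c; apply: val_inj; exact: bmulDl. Qed.

Fact subalgebra_bmulDr : right_distributive subalgebra_bmul +%R.
Proof. by move=> a b c; apply: val_inj; exact: bmulDr. Qed.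

Fact subalgebra_bmulZl (k : R[i]) (a b : subalgebra) :
  subalgebra_bmul (k *: a) b = k *: subalgebra_bmul a b.
Proof. by apply: val_inj; exact: bmulZl. Qed.

Fact subalgebra_bmulZr (k : R[i]) (a b : subalgebra) :
  subalgebra_bmul a (k *: b) = k *: subalgebra_bmul a b.
Proof. by apply: val_inj; exact: bmulZr. Qed.

Fact subalgebra_ler_normbM (a b : subalgebra) :
  `|subalgebra_bmul a b| <= `|a| * `|b|.
Proof. exact: ler_normbM. Qed.

HB.instance Definition _ := isBanachAlgebra.Build R[i] subalgebra
  subalgebra_bmulA subalgebra_bmulDl subalgebra_bmulDr
  subalgebra_bmulZl subalgebra_bmulZr subalgebra_ler_normbM.

Fact dual_restr_functional (f : tdual A) :
  (fun a : subalgebra => f (val a)) \in @functional R subalgebra.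
Proof.
apply: (@bounded_functional _ _ _ `|f|) => [c a b|a].
  exact: (linearP f).
exact: le_dual_norm.
Qed.
Definition dual_restr (f : tdual A) : tdual subalgebra :=
  Dual (dual_restr_functional f).

End Subalgebra.

Section Arens.
Variables (R : realType) (A : banachAlgType R[i]).
Implicit Types (a b : A) (f : tdual A) (m n : tdual (tdual A)).

Fact ract_functional f a : (fun b => f (a ** b)) \in @functional R A.
Proof.
apply: (@bounded_functional _ _ _ (`|f| * `|a|)) => [k b c|b].
  by rewrite bmulDr bmulZr linearP.
rewrite -mulrA (le_trans (ler_dualM _ _)) // ler_wpM2l //.
exact: ler_normbM.
Qed.
(* f . a *)
Definition ract f a : tdual A := Dual (ract_functional f a).

Fact lact_functional a f : (fun b => f (b ** a)) \in @functional R A.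
Proof.
apply: (@bounded_functional _ _ _ (`|f| * `|a|)) => [k b c|b].
  by rewrite bmulDl bmulZl linearP.
rewrite -mulrA (le_trans (ler_dualM _ _)) // ler_wpM2l //.
by rewrite mulrC ler_normbM.
Qed.
(* a . f *)
Definition lact a f : tdual A := Dual (lact_functional a f).

Lemma norm_ract f a : `|ract f a| <= `|f| * `|a|.
Proof.
apply: dual_norm_le => [|b]; first by rewrite mulr_ge0.
rewrite -mulrA (le_trans (ler_dualM f _)) // ler_wpM2l //.
exact: ler_normbM.
Qed.

Lemma norm_lact a f : `|lact a f| <= `|f| * `|a|.
Proof.
apply: dual_norm_le => [|b]; first by rewrite mulr_ge0.
rewrite -mulrA (le_trans (ler_dualM f _)) // ler_wpM2l //.
by rewrite mulrC ler_normbM.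
Qed.

Fact bidual_lact_functional n f : (fun a => n (ract f a)) \in @functional R A.
Proof.
apply: (@bounded_functional _ _ _ (`|n| * `|f|)) => [k a b|a].
  rewrite -linearP; congr (n _); apply: dualP => c /=.
  by rewrite bmulDl bmulZl linearP.
rewrite -mulrA (le_trans (ler_dualM n _)) // ler_wpM2l //.
exact: norm_ract.
Qed.
(* n . f, for the left Arens product *)
Definition bidual_lact n f : tdual A := Dual (bidual_lact_functional n f).

Fact bidual_ract_functional f m : (fun a => m (lact a f)) \in @functional R A.
Proof.
apply: (@bounded_functional _ _ _ (`|m| * `|f|)) => [k a b|a].
  rewrite -linearP; congr (m _); apply: dualP => c /=.
  by rewrite bmulDr bmulZr linearP.
rewrite -mulrA (le_trans (ler_dualM m _)) // ler_wpM2l //.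
exact: norm_lact.
Qed.
(* f \bigtriangleup m, for the right Arens product *)
Definition bidual_ract f m : tdual A := Dual (bidual_ract_functional f m).

Fact arensl_functional m n :
  (fun f => m (bidual_lact n f)) \in @functional R (tdual A).
Proof.
apply: (@bounded_functional _ _ _ (`|m| * `|n|)) => [k f g|f].
  rewrite -linearP; congr (m _); apply: dualP => a.
  rewrite -[RHS]/(k *: n (ract f a) + n (ract g a)) -linearP.
  by congr (n _); exact: dualP.
rewrite -mulrA (le_trans (ler_dualM m _)) // ler_wpM2l //.
apply: dual_norm_le => [|a]; first by rewrite mulr_ge0.
rewrite -mulrA (le_trans (ler_dualM n _)) // ler_wpM2l //.
exact: norm_ract.
Qed.
(* Left Arens product m . n *)
Definition arensl m n : tdual (tdual A) := Dual (arensl_functional m n).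

Fact arensr_functional m n :
  (fun f => n (bidual_ract f m)) \in @functional R (tdual A).
Proof.
apply: (@bounded_functional _ _ _ (`|n| * `|m|)) => [k f g|f].
  rewrite -linearP; congr (n _); apply: dualP => a.
  rewrite -[RHS]/(k *: m (lact a f) + m (lact a g)) -linearP.
  by congr (m _); exact: dualP.
rewrite -mulrA (le_trans (ler_dualM n _)) // ler_wpM2l //.
apply: dual_norm_le => [|a]; first by rewrite mulr_ge0.
rewrite -mulrA (le_trans (ler_dualM m _)) // ler_wpM2l //.
exact: norm_lact.
Qed.
(* Right Arens product m \bigtriangleup n *)
Definition arensr m n : tdual (tdual A) := Dual (arensr_functional m n).

(* The sets A^*A and AA^*; they are not spans. *)
Definition AstarA : set (tdual A) := [set ract f a | f in setT & a in setT].
Definition AAstar : set (tdual A) := [set lact a f | a in setT & f in setT].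

Definition left_centre : set (tdual (tdual A)) :=
  [set m | continuous
    (fun n : weak_star (tdual A) => arensl m n : weak_star (tdual A))].

Definition right_centre : set (tdual (tdual A)) :=
  [set m | continuous
    (fun n : weak_star (tdual A) => arensr n m : weak_star (tdual A))].

Definition mixed_identity : set (tdual (tdual A)) :=
  [set E | forall n, arensl n E = n /\ arensr E n = n].

End Arens.

Section ApproximateIdentity.

Record directed (I : Type) (le : I -> I -> Prop) : Prop := {
  directed_inhabited : inhabited I;
  directed_refl : forall i, le i i;
  directed_trans : forall i j k, le i j -> le j k -> le i k;
  directed_ub : forall i j, exists k, le i k /\ le j k }.

(* Eventuality filter of the net indexed by [(I, le)]. *)
Definition tails (I : Type) (le : I -> I -> Prop) : set_system I :=
  [set U | exists i, forall j, le i j -> U j].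

Variables (K : numFieldType) (A : banachAlgType K).

Record is_bai (I : Type) (le : I -> I -> Prop) (e : I -> A) : Prop := {
  bai_directed : directed le;
  bai_bounded : exists M : K, forall i, `|e i| <= M;
  bai_left : forall a : A, e i ** a @[i --> tails le] --> a;
  bai_right : forall a : A, a ** e i @[i --> tails le] --> a }.

Definition has_bai : Prop :=
  exists (I : Type) (le : I -> I -> Prop) (e : I -> A), is_bai le e.

Definition has_sequential_bai : Prop :=
  exists e : nat -> A, is_bai (fun i j : nat => (i <= j)%N) e.

End ApproximateIdentity.

Section Multipliers.
Variables (R : realType) (A : banachAlgType R[i]).
Implicit Types (T : A -> A) (S : closed_subalgebra A).

Definition left_multiplier : set (A -> A) :=
  [set T | [/\ linear T, continuous T & forall a b, T (a ** b) = T a ** b]].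

Definition right_multiplier : set (A -> A) :=
  [set T | [/\ linear T, continuous T & forall a b, T (a ** b) = a ** T b]].

Definition is_left_mult T : Prop := exists a, forall x, T x = a ** x.

Definition is_right_mult T : Prop := exists a, forall x, T x = x ** a.

(* The restriction of [T] to [S] is multiplication by an element of [S]; in
   particular [T] maps [S] into itself. *)
Definition is_left_mult_on S T : Prop :=
  exists c : subalgebra S, forall x : subalgebra S, T (val x) = val c ** val x.

Definition is_right_mult_on S T : Prop :=
  exists c : subalgebra S, forall x : subalgebra S, T (val x) = val x ** val c.

Definition two_sided_ideal S : Prop :=
  forall (b : A) x, subalgebra_set S x ->
    subalgebra_set S (b ** x) /\ subalgebra_set S (x ** b).

Record bimodule_projection S (p : A -> subalgebra S) : Prop := {
  projection_linear : linear p;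
  projection_continuous : continuous p;
  projectionMl : forall b x : A, val (p (b ** x)) = b ** val (p x);
  projectionMr : forall x b : A, val (p (x ** b)) = val (p x) ** b;
  projection_id : forall x : subalgebra S, p (val x) = x }.

Record wsc_ideal_family (I : Type) (J : I -> closed_subalgebra A) : Prop := {
  family_ideal : forall i, two_sided_ideal (J i);
  family_wsc : forall i, weakly_sequentially_complete (subalgebra (J i));
  family_bai : forall i, has_sequential_bai (subalgebra (J i));
  family_projection : forall i,
    exists p : A -> subalgebra (J i), bimodule_projection p }.

Definition bai_extends S : Prop :=
  forall (I : Type) (le : I -> I -> Prop) (e : I -> subalgebra S),
    is_bai le e -> is_bai le (fun i => val (e i) : A).

End Multipliers.

Section Types.
Variables (R : realType) (A : banachAlgType R[i]).

Record LM_witness (mu : A -> A) (S : closed_subalgebra A)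
    (I : Type) (J : I -> closed_subalgebra (subalgebra S)) : Prop := {
  LM_bai : has_bai (subalgebra S);
  LM_family : wsc_ideal_family J;
  LM_local : forall nu : subalgebra S -> subalgebra S, left_multiplier nu ->
    (forall i, is_left_mult_on (J i) nu) -> is_left_mult nu;
  LM_restr : forall f : tdual A, AstarA f -> AstarA (dual_restr S f);
  LM_stable : forall x, subalgebra_set S x -> subalgebra_set S (mu x);
  LM_extend : is_left_mult_on S mu -> is_left_mult mu;
  LM_every_bai : bai_extends S }.

Record RM_witness (mu : A -> A) (S : closed_subalgebra A)
    (I : Type) (J : I -> closed_subalgebra (subalgebra S)) : Prop := {
  RM_bai : has_bai (subalgebra S);
  RM_family : wsc_ideal_family J;
  RM_local : forall nu : subalgebra S -> subalgebra S, right_multiplier nu ->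
    (forall i, is_right_mult_on (J i) nu) -> is_right_mult nu;
  RM_restr : forall f : tdual A, AAstar f -> AAstar (dual_restr S f);
  RM_stable : forall x, subalgebra_set S x -> subalgebra_set S (mu x);
  RM_extend : is_right_mult_on S mu -> is_right_mult mu;
  RM_every_bai : bai_extends S }.

Definition type_LM : Prop :=
  has_bai A /\ forall mu, left_multiplier mu ->
    exists (S : closed_subalgebra A) (I : Type)
      (J : I -> closed_subalgebra (subalgebra S)), LM_witness mu J.

Definition type_RM : Prop :=
  has_bai A /\ forall mu, right_multiplier mu ->
    exists (S : closed_subalgebra A) (I : Type)
      (J : I -> closed_subalgebra (subalgebra S)), RM_witness mu J.

Definition type_M : Prop := type_LM /\ type_RM.

End Types.

(* Main.v *)
(* Suppose m.A is contained in A (the other side is symmetric).  Then mu : a |->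
   m.a is a left multiplier, and m /\ E = m for all mixed identities E says that
   f(mu(e_i)) converges to m(f) for every BAI (e_i) of A and f in A^*, since the
   limits of a BAI along ultrafilters are mixed identities.  Let B, B_i and
   p : B -> B_i be as in type (LM^+), (b_k) a BAI of B, (e_n) a sequential BAI
   of B_i.  Then b_k - p(b_k) + e_n is again a BAI of B, hence of A; fixing k
   shows that (mu(e_n)) is weakly Cauchy.  Its weak limit c in B_i satisfies
   mu(x) = cx on B_i, so mu is left multiplication by some a in A, and
   m = m /\ E = a.  The centre conditions are reduced to this case by the
   weak-star density of A in A^**. *)
From HB Require Import structures.
Require Import Defs.
From mathcomp Require Import all_boot all_order all_algebra.
From mathcomp Require Import complex ring lra.
From mathcomp Require Import all_classical all_reals all_analysis.

Set Implicit Arguments.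
Unset Strict Implicit.
Unset Printing Implicit Defensive.

Import Order.TTheory GRing.Theory Num.Theory.
Import numFieldNormedType.Exports.

Local Open Scope classical_set_scope.
Local Open Scope ring_scope.
Local Open Scope complex_scope.

(** * The Hahn-Banach theorem *)

Section RealHahnBanach.
Variables (R : realType) (V : lmodType R) (p : V -> R).
Hypothesis pD : forall x y, p (x + y) <= p x + p y.
Hypothesis pZ : forall (r : R) x, 0 <= r -> p (r *: x) = r * p x.

(* Functionality of such a graph needs no clause: [(0, a)] in the graph forces
   [a <= p 0 = 0] and [- a <= 0]. *)
Definition dominated_graph (G : set (V * R)) : Prop :=
  [/\ G (0, 0),
      forall (r : R) x a y b,
        G (x, a) -> G (y, b) -> G (r *: x + y, r * a + b) &
      forall x a, G (x, a) -> a <= p x].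

Lemma dominated_graph_inj G x a b :
  dominated_graph G -> G (x, a) -> G (x, b) -> a = b.
Proof.
move=> [G0 GL Gp].
have p0 : p 0 = 0 by rewrite -(scale0r 0) pZ // mul0r.
suff le c d : G (x, c) -> G (x, d) -> d <= c.
  by move=> Ga Gb; apply/eqP; rewrite eq_le !le.
move=> Gc Gd; have := Gp _ _ (GL (-1) _ _ _ _ Gc Gd).
by rewrite scaleN1r addNr p0 mulN1r addrC subr_le0.
Qed.

(** The value [c] at [x0] must lie above every [a - p (x - x0)] and below every [p (y + x0) - b].
    Subadditivity puts each lower bound below each upper one, and [c] is the supremum of the lower
    ones. If [x0] is already in the domain, both bounds force its old value. *)
Lemma dominated_graph_extend G x0 : dominated_graph G ->
  exists G', [/\ dominated_graph G', G `<=` G' & exists c, G' (x0, c)].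
Proof.
move=> [G0 GL Gp].
pose E := [set z.2 - p (z.1 - x0) | z in G].
have Eub y b : G (y, b) -> ubound E (p (y + x0) - b).
  move=> Gy _ [[x a] /= Gx <-].
  have := Gp _ _ (GL 1 _ _ _ _ Gx Gy); rewrite scale1r mul1r => ab.
  have : p (x + y) <= p (x - x0) + p (y + x0).
    by apply: le_trans (pD _ _); rewrite addrACA addNr addr0.
  by move: ab; lra.
have E0 : E !=set0.
  by exists (0 - p (0 - x0)), (0, 0).
have hE : has_ubound E by exists (p (0 + x0) - 0); exact: Eub.
pose c := sup E.
have c_ge x a : G (x, a) -> a - p (x - x0) <= c.
  by move=> Gx; apply: ub_le_sup => //; exists (x, a).
have c_le y b : G (y, b) -> c <= p (y + x0) - b.
  by move=> Gy; apply: ge_sup => //; exact: Eub.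
exists [set z | exists x a t, G (x, a) /\ z = (x + t *: x0, a + t * c)].
split; first split.
- by exists 0, 0, 0; rewrite scale0r mul0r !addr0.
- move=> r _ _ _ _ [x [a [t [Gx [-> ->]]]]] [y [b [s [Gy [-> ->]]]]].
  exists (r *: x + y), (r * a + b), (r * t + s); split; first exact: GL.
  by congr pair; [rewrite scalerDr scalerDl scalerA addrACA|ring].
- move=> _ _ [x [a [t [Gx [-> ->]]]]].
  have GZ r : G (r *: x, r * a).
    by have := GL r _ _ _ _ Gx G0; rewrite !addr0.
  (* By homogeneity, dividing by [|t|] turns the claim into the upper bound on [c] for [t > 0] and
     the lower bound for [t < 0]. *)
  have [t0|t0|->] := ltrgt0P t; last by rewrite scale0r mul0r !addr0 Gp.
    have := c_le _ _ (GZ t^-1).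
    rewrite -(ler_pM2l t0) mulrBr -pZ ?(ltW t0) // scalerDr !mulrA scalerA.
    by rewrite divff ?gt_eqF // scale1r mul1r; lra.
  have s0 : 0 < - t by rewrite oppr_gt0.
  have := c_ge _ _ (GZ (- t)^-1).
  rewrite -(ler_pM2l s0) mulrBr -pZ ?(ltW s0) // scalerBr !mulrA scalerA.
  by rewrite divff ?gt_eqF // scale1r mul1r scaleNr opprK; lra.
- by move=> [x a] Gx; exists x, a, 0; rewrite scale0r mul0r !addr0.
- by exists c, 0, 0, 1; rewrite scale1r mul1r !add0r.
Qed.

Lemma dominated_graph_total G0 : dominated_graph G0 ->
  exists G, [/\ dominated_graph G, G0 `<=` G & forall x, exists a, G (x, a)].
Proof.
(* Zorn's lemma also asks for a bound of the empty chain; adding [G0] to each member makes the empty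
   set admissible. *)
move=> dG0; pose P : set (set (V * R)) := [set A | dominated_graph (A `|` G0)].
have [F FP Ftot|A [PA Amax]] := @Zorn_bigcup _ P.
  have [->|/set0P[A0 FA0]] := eqVneq F set0.
    by rewrite /P /= bigcup_set0 set0U.
  have step z w : (\bigcup_(X in F) X `|` G0) z ->
      (\bigcup_(X in F) X `|` G0) w ->
      exists2 A, F A & (A `|` G0) z /\ (A `|` G0) w.
    move=> [[A FA Az]|Gz] [[B FB Bw]|Gw].
    - have [AB|BA] := Ftot _ _ FA FB.
        by exists B => //; split; left=> //; exact: AB.
      by exists A => //; split; left=> //; exact: BA.
    - by exists A => //; split; [left|right].
    - by exists B => //; split; [right|left].
    - by exists A0 => //; split; right.
  have sub A : F A -> A `|` G0 `<=` \bigcup_(X in F) X `|` G0.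
    by move=> FA z [Az|]; [left; exists A|right].
  split; first by right; case: dG0.
  - move=> r x a y b Gx Gy; have [A FA [Ax Ay]] := step _ _ Gx Gy.
    by apply: (sub A) => //; have [_ AL _] := FP A FA; exact: AL.
  - move=> x a Gx; have [A FA [Ax _]] := step _ _ Gx Gx.
    by have [_ _ Ap] := FP A FA; exact: Ap.
exists (A `|` G0); split => // x0.
have [G' [dG' AG' [c G'c]]] := @dominated_graph_extend _ x0 PA.
exists c; left; apply: contrapT => nAc; apply: (Amax G').
  split; first by move=> z Az; apply: AG'; left.
  by move=> /(_ _ G'c).
rewrite /P /=; suff -> : G' `|` G0 = G' by [].
by rewrite setUidl // => z Gz; apply: AG'; right.
Qed.

(** The image of [w |-> (j w, f w)] is a dominated graph; domination forces [f] to vanish on the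
    kernel of [j], so the graph is single-valued. *)
Theorem hahn_banach_real (W : lmodType R) (j : {linear W -> V})
    (f : {scalar W}) : (forall w, f w <= p (j w)) ->
  exists F : V -> R, [/\ scalar F, forall w, F (j w) = f w &
    forall x, F x <= p x].
Proof.
move=> fp; pose G0 : set (V * R) := [set (j w, f w) | w in setT].
have [|G [dG G0G Gtot]] := @dominated_graph_total G0.
  split.
  - by exists 0 => //; rewrite !linear0.
  - move=> r _ _ _ _ [x _ [<- <-]] [y _ [<- <-]].
    by exists (r *: x + y) => //; congr pair; exact: linearP.
  - by move=> _ _ [x _ [<- <-]].
pose F x := projT1 (cid (Gtot x)).
have GF x : G (x, F x) by rewrite /F; case: cid.
have [_ GL Gp] := dG; exists F; split=> [r x y|w|x]; last exact: Gp.
  by apply: dominated_graph_inj dG (GF _) _; exact: GL.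
by apply: dominated_graph_inj dG (GF _) _; apply: G0G; exists w.
Qed.

End RealHahnBanach.

(** * The complex Hahn-Banach theorem, through real parts *)

Section ComplexHahnBanach.
Variable R : realType.

(** An alias keeps the restriction of scalars to [R] apart from the complex module structure on the
    same set. *)
Definition realification (V : lmodType R[i]) : Type := V.

Section Realification.
Variable V : lmodType R[i].

HB.instance Definition _ := GRing.Zmodule.on (realification V).

Definition real_scale (r : R) (x : realification V) : realification V :=
  r%:C *: (x : V).

Fact real_scaleA r s x : real_scale r (real_scale s x) = real_scale (r * s) x.
Proof. by rewrite /real_scale scalerA rmorphM. Qed.

Fact real_scale1 : left_id 1 real_scale.
Proof. by move=> x; rewrite /real_scale scale1r. Qed.

Fact real_scaleDr : right_distributive real_scale +%R.
Proof. by move=> r x y; exact: scalerDr. Qed.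

Fact real_scaleDl x : {morph real_scale^~ x : r s / r + s}.
Proof. by move=> r s; rewrite /real_scale rmorphD; exact: scalerDl. Qed.

HB.instance Definition _ := GRing.Zmodule_isLmodule.Build R (realification V)
  real_scaleA real_scale1 real_scaleDr real_scaleDl.

Lemma real_scaleE (r : R) (x : realification V) : r *: x = r%:C *: (x : V).
Proof. by []. Qed.

End Realification.

Variables V W : normedModType R[i].

(** The complex-linear functional with real part [u], namely [u x - i u (i x)]. *)
Definition complexify (u : realification V -> R) (x : V) : R[i]^o :=
  u x +i* - u ('i *: x).

Lemma complexify_linear (u : realification V -> R) :
  scalar u -> linear (complexify u).
Proof.
move=> uL [r s] x y; rewrite /complexify.
have uD z t : u (z + t) = u z + u t.
  by rewrite -[z]scale1r uL mul1r scale1r.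
have u0 : u 0 = 0 by apply: (addrI (u 0)); rewrite -uD !addr0.
have uZ c z : u (c%:C *: (z : V)) = c * u z.
  by have := uL c z 0; rewrite u0 !addr0.
have -> : (r +i* s) *: x = r%:C *: x + s%:C *: ('i *: x).
  rewrite scalerA -scalerDl; congr (_ *: _).
  by apply/eqP; rewrite eq_complex /=; apply/andP; split; apply/eqP; ring.
have -> : 'i *: (r%:C *: x + s%:C *: ('i *: x) + y) =
   r%:C *: ('i *: x) + (- s)%:C *: x + 'i *: y.
  rewrite !scalerDr !scalerA; congr (_ *: _ + _ *: _ + _);
  by apply/eqP; rewrite eq_complex /=; apply/andP; split; apply/eqP; ring.
rewrite !uD !uZ; apply/eqP; rewrite eq_complex /=.
by apply/andP; split; apply/eqP; ring.
Qed.

(* Rotating [x] makes [complexify u x] real, so that it equals [u]. *)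
Lemma complexify_le (M : R[i]) (u : realification V -> R) : scalar u ->
    (forall x, (u x)%:C <= M * `|x : V|) ->
  forall x, `|complexify u x| <= M * `|x|.
Proof.
move=> /complexify_linear FL uM x; set F := complexify u in FL *.
have F0 : F 0 = 0 by have := FL (-1) 0 0; rewrite scaler0 addr0 scaleN1r addNr.
pose t : R[i] := if F x == 0 then 1 else `|F x| / F x.
have nt : `|t| = 1.
  rewrite /t; case: eqVneq => [|Fx0]; first by rewrite normr1.
  by rewrite normrM normfV normr_id divff // normr_eq0.
have FE : F (t *: x) = `|F x|.
  have := FL t x 0; rewrite F0 !addr0 /t => ->.
  by case: eqVneq => [->|Fx0]; rewrite ?scaler0 ?normr0 //; exact: divfK.
rewrite -FE.
have -> : F (t *: x) = (u (t *: x))%:C.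
  by rewrite -[RHS]/((complex.Re (F (t *: x)))%:C) FE RRe_real ?normr_real.
by apply: le_trans (uM _) _; rewrite normrZ nt mul1r.
Qed.

Theorem hahn_banach (j : {linear W -> V}) (f : tdual W) (M : R[i]) :
    0 <= M -> (forall w, `|f w| <= M * `|j w|) ->
  exists F : tdual V, (forall w, F (j w) = f w) /\ `|F| <= M.
Proof.
move=> M0 fM.
pose p (x : realification V) := complex.Re (M * `|x : V|).
have pE x : (p x)%:C = M * `|x : V| by rewrite RRe_real ?ger0_real // mulr_ge0.
have pD x y : p (x + y) <= p x + p y.
  by rewrite -lecR rmorphD /= !pE -mulrDr ler_wpM2l // ler_normD.
have pZ (r : R) x : 0 <= r -> p (r *: x) = r * p x.
  move=> r0; apply: complexI; rewrite rmorphM /= !pE normrZ ger0_norm ?lecR //.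
  by rewrite mulrCA.
pose jr : {linear realification W -> realification V} :=
  HB.pack (j : realification W -> realification V)
    (GRing.isLinear.Build R (realification W) (realification V) *:%R
      (j : realification W -> realification V)
      (fun r => linearP j r%:C)).
have fr_scalar : scalar (fun w : realification W => complex.Re (f w)).
  move=> r x y; rewrite real_scaleE linearP raddfD /=.
  by case: (f x) => a b; rewrite /= mul0r subr0.
pose fr : {scalar realification W} :=
  HB.pack (fun w : realification W => complex.Re (f w))
    (GRing.isLinear.Build R (realification W) R *%R _ fr_scalar).
have frp w : fr w <= p (jr w).
  by rewrite -lecR pE; apply: le_trans (fM w); apply: le_trans (normc_ge_Re _);
     rewrite lecR ler_norm.
have [u [uL uj up]] := hahn_banach_real pD pZ frp.
have uM x : (u x)%:C <= M * `|x : V| by rewrite -pE lecR.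
have Fle := complexify_le uL uM.
exists (Dual (bounded_functional (complexify_linear uL) Fle)); split=> [w|].
  rewrite /= /complexify -linearZ (uj w) (uj ('i *: w)) /= linearZ.
  have -> : complex.Re ('i *: f w) = - complex.Im (f w).
    by rewrite /GRing.scale /=; case: (f w : R[i]) => a b /=; ring.
  by rewrite opprK; case: (f w : R[i]).
exact: dual_norm_le.
Qed.
End ComplexHahnBanach.

Section HahnBanachConsequences.
Variable R : realType.


Lemma dual_extend (A : banachAlgType R[i]) (S : closed_subalgebra A)
  (f : tdual (subalgebra S)) : exists F : tdual A, dual_restr S F = f.
Proof.
have vL : linear (val : subalgebra S -> A) by [].
pose j : {linear subalgebra S -> A} :=
  HB.pack (val : subalgebra S -> A) (GRing.isLinear.Build _ _ _ _ _ vL).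
have [F [Ff _]] := hahn_banach (j := j) (normr_ge0 f) (ler_dualM f).
by exists F; apply: dualP => x; exact: Ff.
Qed.

Variable V : normedModType R[i].

(** Extend [t |-> t * |x|] along [t |-> t *: x] with bound 1, then evaluate at [t = 1]. *)
Lemma norming_functional (x : V) :
  exists f : tdual V, `|f| <= 1 /\ f x = `|x|.
Proof.
have fF : (fun t : R[i]^o => t * `|x| : R[i]^o) \in @functional R R[i]^o.
  apply: (bounded_functional (M := `|x|)) => [a b c|t].
    by rewrite mulrDl -mulrA.
  by rewrite normrM normr_id mulrC.
have jL : linear (fun t : R[i]^o => t *: x).
  by move=> a b c; rewrite scalerDl -scalerA.
pose j : {linear R[i]^o -> V} :=
  HB.pack (fun t : R[i]^o => t *: x) (GRing.isLinear.Build _ _ _ _ _ jL).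
have jle t : `|Dual fF t| <= 1 * `|j t|.
  by rewrite mul1r /= normrM normr_id normrZ.
have [F [Fj F1]] := hahn_banach ler01 jle.
by exists F; split => //; have := Fj 1; rewrite /= scale1r mul1r.
Qed.

Lemma dual_separates (x y : V) : (forall f : tdual V, f x = f y) -> x = y.
Proof.
move=> fxy; have [f [_ fE]] := norming_functional (x - y).
apply/eqP; rewrite -subr_eq0 -normr_eq0 -fE.
by rewrite linearB /= fxy subrr.
Qed.

Lemma bidual_inj_norm (x : V) : `|x| <= `|bidual_inj x|.
Proof.
have [f [f1 fx]] := norming_functional x.
have := ler_dualM (bidual_inj x) f; rewrite /= fx normr_id => /le_trans; apply.
by rewrite ler_piMr.
Qed.

End HahnBanachConsequences.

(** * Weak-star density and ultrafilter limits *)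

Section WeakStarDensity.
Variables (R : realType) (V : normedModType R[i]).
Implicit Types (f g : tdual V) (E : tdual (tdual V)) (s : seq (tdual V)).

Lemma bidual_vanishes_on_span s f E :
    (forall x, (forall g, g \in s -> g x = 0) -> f x = 0) ->
    (forall g, g \in s -> E g = 0) ->
  E f = 0.
Proof.
elim: s f => [|h s IHs] f kerf Es.
  have -> : f = 0 by apply: dualP => x; exact: kerf.
  exact: linear0.
have Es' g : g \in s -> E g = 0 by move=> gs; rewrite Es // inE gs orbT.
have [[x0 [sx0 hx0]]|nx0] :=
    pselect (exists x0, (forall g, g \in s -> g x0 = 0) /\ h x0 != 0);
    last first.
  apply: IHs => // x sx; apply: kerf => g.
  rewrite inE => /predU1P[->|]; last exact: sx.
  by apply/eqP/negPn/negP => hx; apply: nx0; exists x.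
have : E (f - (f x0 / h x0) *: h) = 0.
  apply: IHs => // x sx.
  have : f (x - (h x / h x0) *: x0) = 0.
    apply: kerf => g; rewrite inE => /predU1P[->|gs].
      by rewrite linearB linearZ /= [_ *: _]divfK ?subrr.
    by rewrite linearB linearZ /= (sx g gs) (sx0 g gs) scaler0 subrr.
  rewrite linearB linearZ /= => /eqP; rewrite subr_eq0 => /eqP fx.
  rewrite -[LHS]/(f x - f x0 / h x0 * h x) fx -[_ *: _]/(_ * _).
  by apply/eqP; rewrite subr_eq0; apply/eqP; field.
rewrite linearB linearZ /= (Es h (mem_head _ _)) => /eqP.
by rewrite scaler0 subr0 => /eqP.
Qed.

(** A point [x0] killed by [s] but not by [h] corrects the value at [h] without disturbing those at
    [s]. If there is none, [h] depends on [s], and its value is already right. *)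
Lemma bidual_interpolation s E : exists a : V, forall f, f \in s -> f a = E f.
Proof.
elim: s => [|h s [a sa]]; first by exists 0.
have [[x0 [sx0 hx0]]|nx0] :=
    pselect (exists x0, (forall g, g \in s -> g x0 = 0) /\ h x0 != 0).
  exists (a + ((E h - h a) / h x0) *: x0) => f.
  rewrite inE linearD linearZ /= => /predU1P[->|fs].
    by rewrite [_ *: _]divfK // addrC subrK.
  by rewrite (sx0 f fs) scaler0 addr0 sa.
exists a => f; rewrite inE => /predU1P[->|]; last exact: sa.
suff /eqP : (E - bidual_inj a) h = 0 by rewrite subr_eq0 => /eqP ->.
apply: (@bidual_vanishes_on_span s) => [x sx|g gs].
  by apply/eqP/negPn/negP => hx; apply: nx0; exists x.
by rewrite -[LHS]/(E g - g a) sa // subrr.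
Qed.

(** The filter is generated by the solution sets of finite interpolation problems, so [f a] is
    eventually equal to [E f]. *)
Lemma bidual_inj_dense E : exists F : set_system V, ProperFilter F /\
  forall f, f a @[a --> F] --> E f.
Proof.
pose F : set_system V :=
  [set U | exists s, forall a : V, (forall f, f \in s -> f a = E f) -> U a].
have FF : ProperFilter F.
  apply: Build_ProperFilter_ex => [U [s sU]|].
    by have [a /sU] := bidual_interpolation s E; exists a.
  split=> [|P Q [s sP] [t tQ]|P Q PQ [s sP]].
  - by exists [::].
  - exists (s ++ t) => a sta.
    by split; [apply: sP|apply: tQ] => f fs; apply: sta;
       rewrite mem_cat fs ?orbT.
  - by exists s => a /sP; exact: PQ.
exists F; split=> // f; apply: cvg_near_cst.
by exists [:: f] => a; apply; exact: mem_head.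
Qed.

End WeakStarDensity.

Section UltrafilterLimits.
Variables (R : realType) (I : Type) (U : set_system I).
Context {UU : UltraFilter U}.

Lemma ultra_bounded_cvg_real (h : I -> R) (r : R) :
  (forall i, `|h i| <= r) -> exists l, h i @[i --> U] --> (l : R).
Proof.
move=> hr; have [|l [_ cl]] :=
  @segment_compact R (- r) r (h @ U) (fmap_proper_filter h _).
  by apply: (filterE (F := U)) => i; rewrite /= in_itv /= -ler_norml.
exists l => N Nl; have [//|nN] := in_ultra_setVsetC (h @^-1` N) UU.
by have [x [nNx /nNx]] := cl (~` N) N nN Nl.
Qed.

Lemma ultra_bounded_cvg (g : I -> R[i]^o) (M : R[i]) :
  (forall i, `|g i| <= M) -> exists l, g i @[i --> U] --> (l : R[i]^o).
Proof.
move=> gM.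
have M0 : (complex.Re M)%:C = M.
  have [i _] := @filter_ex _ U _ _ filterT.
  by rewrite RRe_real // ger0_real // (le_trans _ (gM i)).
have [|a ga] :=
    @ultra_bounded_cvg_real (fun i => complex.Re (g i)) (complex.Re M).
  by move=> i; rewrite -lecR M0 (le_trans (normc_ge_Re _)).
have [|b gb] :=
    @ultra_bounded_cvg_real (fun i => complex.Im (g i)) (complex.Re M).
  move=> i; rewrite -lecR M0 (le_trans _ (gM i)) //.
  by rewrite normc_def lecR -[leLHS]sqrtr_sqr ler_wsqrtr // lerDr sqr_ge0.
exists (a +i* b); apply/cvgrPdist_lt => e e0.
have eE : e = (complex.Re e)%:C by rewrite RRe_real // gtr0_real.
have e20 : 0 < complex.Re e / 2 by rewrite divr_gt0 // -ltcR -eE.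
move/cvgrPdist_lt : ga => /(_ _ e20) ga.
move/cvgrPdist_lt : gb => /(_ _ e20) gb.
near=> i.
have -> : a +i* b - g i =
    (a - complex.Re (g i))%:C + 'i * (b - complex.Im (g i))%:C.
  case: (g i) => x y; apply/eqP; rewrite eq_complex /=.
  by apply/andP; split; apply/eqP; ring.
apply: le_lt_trans (ler_normD _ _) _.
have normi : `|'i : R[i]| = 1.
  by rewrite normc_def /= expr0n expr1n add0r sqrtr1.
have normr (x : R) : `|x%:C| = `|x|%:C.
  by rewrite normc_def /= expr0n addr0 sqrtr_sqr.
rewrite normrM normi mul1r !normr -rmorphD eE ltcR [ltRHS]splitr.
by rewrite ltrD //; near: i.
Unshelve. all: by end_near. Qed.

End UltrafilterLimits.

Lemma cvg_norm_le (R : realType) (I : Type) (F : set_system I)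
    (FF : ProperFilter F) (g : I -> R[i]^o) (l : R[i]^o) (M : R[i]) :
  g i @[i --> F] --> l -> (forall i, `|g i| <= M) -> `|l| <= M.
Proof.
move=> gl gM; have [i0 _] := @filter_ex _ F _ _ filterT.
(* The order on [R[i]] is partial: [M] must be known to be real before it can be compared with
   [|l|]. *)
have M0 : M \is Num.real by rewrite ger0_real // (le_trans _ (gM i0)).
have [//|Ml] := real_leP (normr_real l) M0.
have lM : 0 < `|l| - M by rewrite subr_gt0.
move/cvgrPdist_lt : gl => /(_ _ lM) gl; have [i gi] := filter_ex gl.
have : `|l| < `|l|; last by rewrite ltxx.
rewrite -[X in `|X| < _](subrK (g i)) (le_lt_trans (ler_normD _ _)) //.
by rewrite -[ltRHS](subrK M) ltr_leD.
Qed.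

(** * Mixed identities as ultrafilter limits of bounded approximate identities *)

Section MixedIdentities.
Variables (R : realType) (A : banachAlgType R[i]).
Variables (I : Type) (le : I -> I -> Prop).
Implicit Types (f : tdual A) (m n E : tdual (tdual A)).

Lemma tails_proper : directed le -> ProperFilter (tails le).
Proof.
move=> [[i0] le_refl le_trans le_ub]; apply: Build_ProperFilter_ex.
  by move=> P [i Pi]; exists i; apply: Pi.
split=> [|P Q [i Pi] [j Qj]|P Q PQ [i Pi]]; first by exists i0.
  have [k [ik jk]] := le_ub i j; exists k => l kl.
  by split; [apply/Pi/le_trans/kl|apply/Qj/le_trans/kl].
by exists i => j /Pi; exact: PQ.
Qed.

Lemma dual_cvg (V : normedModType R[i]) (J : Type) (F : set_system J)
    {FF : Filter F} (u : J -> V) (x : V) (f : tdual V) :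
  u i @[i --> F] --> x -> f (u i) @[i --> F] --> f x.
Proof. by move=> ux; apply: cvg_comp ux _; exact: dual_continuous. Qed.

Variable e : I -> A.
Hypothesis e_bai : is_bai le e.

(** Put [E f = lim f (e i)]. Then [E (f . a) = lim f (a ** e i) = f a] and
    [E (a . f) = lim f (e i ** a) = f a], so both [bidual_lact E f] and [bidual_ract f E] are
    [f]. *)
Lemma ultra_bai_mixed_identity (U : set_system I) : UltraFilter U ->
    tails le `<=` U ->
  exists E, mixed_identity E /\ forall f, f (e i) @[i --> U] --> E f.
Proof.
move=> UU leU; have [/tails_proper FF [M eM] el er] := e_bai.
have UF := @ultra_proper _ U UU.
have fe_bound f i : `|f (e i)| <= `|f| * M.
  by apply: le_trans (ler_dualM f (e i)) _; rewrite ler_wpM2l.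
have fe_cvg f : exists l : R[i]^o, f (e i) @[i --> U] --> l.
  exact: ultra_bounded_cvg (fe_bound f).
pose E f : R[i]^o := projT1 (cid (fe_cvg f)).
have EP f : f (e i) @[i --> U] --> E f by rewrite /E; case: cid.
have uniq f (l : R[i]^o) : f (e i) @[i --> U] --> l -> E f = l.
  by move=> fl; apply: cvg_unique (EP f) fl.
have E_linear : linear E.
  move=> k f g; apply: uniq.
  by apply: cvgD (EP g); apply: cvgZl_tmp; exact: EP.
have E_le f : `|E f| <= M * `|f|.
  by rewrite mulrC; apply: cvg_norm_le (EP f) _ => i; exact: fe_bound.
exists (Dual (bounded_functional E_linear E_le)); split=> // n.
split; apply: dualP => f; congr (n _); apply: dualP => a; apply: uniq.
  by move=> P /(dual_cvg (er a)) /leU.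
by move=> P /(dual_cvg (el a)) /leU.
Qed.

Lemma has_mixed_identity : exists E : tdual (tdual A), mixed_identity E.
Proof.
have FF := tails_proper (bai_directed e_bai).
have [U [UU leU]] := @ultraFilterLemma _ (tails le) FF.
by have [E [EE _]] := ultra_bai_mixed_identity UU leU; exists E.
Qed.

(** If [f (e i)] were not eventually within [d] of [l], an ultrafilter refining the tails and
    containing the bad indices would yield a mixed identity [E] with [E f] different from [l]. *)
Lemma bai_cvg_of_mixed_identity f (l : R[i]^o) :
    (forall E, mixed_identity E -> E f = l) ->
  f (e i) @[i --> tails le] --> l.
Proof.
move=> El; have FF := tails_proper (bai_directed e_bai).
apply/cvgrPdist_lt => d d0; apply: contrapT => nearNd.
pose D := [set i | ~ `|l - f (e i)| < d].
have DF : ProperFilter (within D (tails le)).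
  split=> [D0|]; last exact: within_filter.
  move: D0; rewrite /within /= => D0.
    apply: nearNd; apply: (@filterS _ (tails le) _ _ _ _ D0) => i.
    exact: contrapT.
have [U [UU DU]] := @ultraFilterLemma _ _ DF.
have leU : tails le `<=` U by move=> P /(cvg_within D) /DU.
have [E [EE Ef]] := ultra_bai_mixed_identity UU leU.
move: (Ef f); rewrite El // => /cvgrPdist_lt /(_ d d0) Ud.
have UD : U D by apply: DU; exact: withinT.
by have [i [/= di /(_ di)]] := filter_ex (filterI Ud UD).
Qed.

End MixedIdentities.

(** * Arens products *)

Section BoundedLinear.
Variables (R : realType) (V W : normedModType R[i]) (T : V -> W).

Lemma bounded_linear_continuous (M : R[i]) :
  linear T -> (forall x, `|T x| <= M * `|x|) -> continuous T.
Proof.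
move=> TL TM.
pose t : {linear V -> W} := HB.pack T (GRing.isLinear.Build _ _ _ _ _ TL).
suff : continuous t by [].
apply/linear_bounded_continuous/linear_boundedP.
near=> r => x; apply: le_trans (TM x) _.
have [->|x0] := eqVneq `|x| 0; first by rewrite !mulr0.
have Mge0 : 0 <= M.
  have := le_trans (normr_ge0 _) (TM x).
  by rewrite pmulr_lge0 // lt_def x0 /=.
rewrite ler_wpM2r // -(ger0_norm Mge0).
by near: r; apply: nbhs_pinfty_ge; rewrite normr_real.
Unshelve. all: by end_near. Qed.

Lemma continuous_linear_bounded :
  linear T -> continuous T -> exists M, 0 <= M /\ forall x, `|T x| <= M * `|x|.
Proof.
move=> TL cT.
pose t : {linear V -> W} := HB.pack T (GRing.isLinear.Build _ _ _ _ _ TL).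
have /linear_bounded_continuous/linear_boundedP := cT : continuous t.
move=> H; near (pinfty_nbhs R[i]) => M.
exists M; split; last by near: M.
by near: M; apply: nbhs_pinfty_ge; rewrite real0.
Unshelve. all: by end_near. Qed.

End BoundedLinear.

Section WeakStarTopology.
Variables (R : realType) (V W : normedModType R[i]).

Lemma weak_star_eval_continuous (x : V) :
  continuous (fun f : weak_star V => (f : tdual V) x : R[i]^o).
Proof.
move=> f; have /(weak_star_cvgP _ (nbhs_filter f)) := @cvg_id _ (nbhs f).
exact.
Qed.

Lemma weak_star_continuous (T : topologicalType) (h : T -> weak_star V) :
    (forall x : V, continuous (fun t => (h t : tdual V) x : R[i]^o)) ->
  continuous h.
Proof.
move=> hc t; apply/(weak_star_cvgP _ (fmap_filter h (nbhs_filter t))) => x.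
exact: hc.
Qed.

End WeakStarTopology.

Section ArensProducts.
Variables (R : realType) (A : banachAlgType R[i]).
Implicit Types (a b : A) (f : tdual A) (m n E : tdual (tdual A)).

Lemma bidual_inj_inj : injective (@bidual_inj R A).
Proof.
move=> a b ab; apply: dual_separates => f.
by rewrite -[LHS]/(bidual_inj a f) ab.
Qed.

Lemma arensl_injr m a f : arensl m (bidual_inj a) f = m (lact a f).
Proof. by congr (m _); apply: dualP. Qed.

Lemma arensr_injl n a f : arensr (bidual_inj a) n f = n (ract f a).
Proof. by congr (n _); apply: dualP. Qed.

(** At [f], the product [a . n] is [n (ract f a)], an evaluation of [n]. *)
Lemma left_centre_inj a : left_centre (bidual_inj a).
Proof.
by apply: weak_star_continuous => f; exact: weak_star_eval_continuous.
Qed.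

Lemma right_centre_inj a : right_centre (bidual_inj a).
Proof.
by apply: weak_star_continuous => f; exact: weak_star_eval_continuous.
Qed.

(** The two products agree when [n] comes from [A]. The right one, being [n (bidual_ract f m)] at
    [f], is always weak-star continuous in [n], the left one is so by hypothesis, and [A] is
    weak-star dense. *)
Lemma left_centre_arens m n : left_centre m -> arensl m n = arensr m n.
Proof.
move=> cm; apply: dualP => f; have [F [FF Fn]] := bidual_inj_dense n.
have Fws : (bidual_inj a : weak_star (tdual A)) @[a --> F] -->
    (n : weak_star (tdual A)).
  by apply/weak_star_cvgP => g; exact: Fn.
have lim1 : (fun a => arensl m (bidual_inj a) f : R[i]^o) @ F -->
    (arensl m n f : R[i]^o).
  by have /weak_star_cvgP /(_ f) := cvg_comp _ _ Fws (cm n).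
have lim2 : (fun a => arensl m (bidual_inj a) f : R[i]^o) @ F -->
    (arensr m n f : R[i]^o).
  rewrite (_ : (fun a => _) = bidual_ract f m); first exact: Fn.
  by apply/funext => a; rewrite arensl_injr.
exact: cvg_unique lim1 lim2.
Qed.

Lemma right_centre_arens m n : right_centre m -> arensr n m = arensl n m.
Proof.
move=> cm; apply: dualP => f; have [F [FF Fn]] := bidual_inj_dense n.
have Fws : (bidual_inj a : weak_star (tdual A)) @[a --> F] -->
    (n : weak_star (tdual A)).
  by apply/weak_star_cvgP => g; exact: Fn.
have lim1 : (fun a => arensr (bidual_inj a) m f : R[i]^o) @ F -->
    (arensr n m f : R[i]^o).
  by have /weak_star_cvgP /(_ f) := cvg_comp _ _ Fws (cm n).
have lim2 : (fun a => arensr (bidual_inj a) m f : R[i]^o) @ F -->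
    (arensl n m f : R[i]^o).
  rewrite (_ : (fun a => _) = bidual_lact m f); first exact: Fn.
  by apply/funext => a; rewrite arensr_injl.
exact: cvg_unique lim1 lim2.
Qed.

(** Injectivity of the canonical embedding transfers linearity from [T] to [mu], and
    [bidual_inj_norm] transfers the bound. *)
Lemma bidual_inj_factor (T : A -> tdual (tdual A)) (M : R[i]) :
    linear T -> (forall a, `|T a| <= M * `|a|) ->
    (forall a, exists b, T a = bidual_inj b) ->
  exists mu : A -> A, [/\ linear mu, continuous mu &
    forall a, T a = bidual_inj (mu a)].
Proof.
move=> TL TM Tinj; pose mu a := projT1 (cid (Tinj a)).
have muE a : T a = bidual_inj (mu a) by rewrite /mu; case: cid.
have muL : linear mu.
  move=> k a b; apply: bidual_inj_inj; rewrite -muE TL !muE.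
  by apply: dualP => f; rewrite /= linearP.
exists mu; split=> //; apply: (@bounded_linear_continuous _ _ _ _ M) => // a.
by apply: le_trans (TM a); rewrite muE bidual_inj_norm.
Qed.

(** Here [mu a] is [m . a] read in [A]. The second clause says that [bidual_ract f m] is [f]
    composed with [mu], which turns conditions on mixed identities into limits of [f (mu (e i))]. *)
Lemma arensl_left_multiplier m :
    (forall a, exists b, arensl m (bidual_inj a) = bidual_inj b) ->
  exists mu : A -> A, left_multiplier mu /\ forall a f, m (lact a f) = f (mu a).
Proof.
move=> mA.
have [||mu [muL muc muE]] := @bidual_inj_factor _ `|m| _ _ mA.
- move=> k a b; apply: dualP => f.
  rewrite arensl_injr.
  rewrite -[RHS]/(k *: arensl m (bidual_inj a) f + arensl m (bidual_inj b) f).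
  rewrite !arensl_injr -linearP; congr (m _); apply: dualP => c /=.
  by rewrite bmulDr bmulZr linearP.
- move=> a; apply: dual_norm_le => [|f]; first by rewrite mulr_ge0.
  rewrite arensl_injr (le_trans (ler_dualM m _)) // -mulrA ler_wpM2l //.
  by rewrite mulrC norm_lact.
have fmu a f : m (lact a f) = f (mu a) by rewrite -arensl_injr muE.
exists mu; split=> //; split=> // a b; apply: dual_separates => f.
rewrite -fmu -[RHS]/(lact b f (mu a)) -fmu; congr (m _); apply: dualP => c.
by rewrite /= bmulA.
Qed.

Lemma arensl_right_multiplier m :
    (forall a, exists b, arensl (bidual_inj a) m = bidual_inj b) ->
  exists mu : A -> A,
    right_multiplier mu /\ forall a f, m (ract f a) = f (mu a).
Proof.
move=> mA.
have [||mu [muL muc muE]] := @bidual_inj_factor _ `|m| _ _ mA.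
- move=> k a b; apply: dualP => f.
  rewrite -[LHS]/(m (ract f (k *: a + b))).
  rewrite -[RHS]/(k *: m (ract f a) + m (ract f b)).
  rewrite -linearP; congr (m _); apply: dualP => c /=.
  by rewrite bmulDl bmulZl linearP.
- move=> a; apply: dual_norm_le => [|f]; first by rewrite mulr_ge0.
  rewrite -[arensl _ _ f]/(m (ract f a)).
  rewrite (le_trans (ler_dualM m _)) // -mulrA ler_wpM2l //.
  by rewrite mulrC norm_ract.
have fmu a f : m (ract f a) = f (mu a).
  by rewrite -[LHS]/(arensl (bidual_inj a) m f) muE.
exists mu; split=> //; split=> // a b; apply: dual_separates => f.
rewrite -fmu -[RHS]/(ract f a (mu b)) -fmu; congr (m _); apply: dualP => c.
by rewrite /= bmulA.
Qed.

End ArensProducts.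

(** * Approximate identities adapted to an ideal *)

Section IdealProjection.
Variables (R : realType) (B : banachAlgType R[i]) (J : closed_subalgebra B).
Variable p : B -> subalgebra J.
Hypothesis J_ideal : two_sided_ideal J.
Hypothesis p_proj : bimodule_projection p.

Lemma projection_ideal x : subalgebra_set J x -> val (p x) = x.
Proof.
move=> Jx; have xJ : x \in subalgebra_pred J by apply/asboolP.
by have /(congr1 val) := projection_id p_proj (Subalgebra xJ).
Qed.

(** The product lies in the ideal, so [p] fixes it, and the bimodule property takes [y] out of
    [p]. *)
Lemma projection_mull x (y : subalgebra J) : x ** val y = val (p x) ** val y.
Proof.
rewrite -(projectionMr p_proj) projection_ideal //.
by have [] := J_ideal x (subalgebraP y).
Qed.

Lemma projection_mulr (y : subalgebra J) x : val y ** x = val y ** val (p x).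
Proof.
rewrite -(projectionMl p_proj) projection_ideal //.
by have [] := J_ideal x (subalgebraP y).
Qed.

Lemma subalgebra_val_continuous (S : closed_subalgebra B) :
  continuous (val : subalgebra S -> B).
Proof.
apply: (@bounded_linear_continuous _ _ _ _ 1) => // x.
by rewrite mul1r.
Qed.

Variables (I : Type) (le : I -> I -> Prop) (b : I -> B).
Variable e : nat -> subalgebra J.
Hypothesis b_bai : is_bai le b.
Hypothesis e_bai : is_bai (fun i j : nat => (i <= j)%N) e.

Definition product_order (x y : I * nat) : Prop := le x.1 y.1 /\ (x.2 <= y.2)%N.

(* Multiplied by [a], the first two terms tend to [a - p a], the last to [p a]. *)
Definition modified_bai (x : I * nat) : B :=
  b x.1 - val (p (b x.1)) + val (e x.2).

Lemma product_order_directed : directed product_order.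
Proof.
have [[i0] le_refl le_trans le_ub] := bai_directed b_bai; split.
- by exists; exact: (i0, 0%N).
- by move=> [i n]; split => /=.
- move=> x y z [xy1 xy2] [yz1 yz2]; split; first exact: le_trans yz1.
  exact: leq_trans yz2.
- move=> [i n] [j k]; have [l [il jl]] := le_ub i j.
  by exists (l, maxn n k); split; split=> //=; rewrite (leq_maxl, leq_maxr).
Qed.

Lemma tails_fst : fst @ tails product_order --> tails le.
Proof.
move=> P [i Pi]; exists (i, 0%N) => -[j n] [/= ij _]; exact: Pi.
Qed.

Lemma tails_snd :
  snd @ tails product_order --> tails (fun i j : nat => (i <= j)%N).
Proof.
have [[i0] _ _ _] := bai_directed b_bai.
move=> P [n Pn]; exists (i0, n) => -[j k] [/= _ nk]; exact: Pn.
Qed.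

Lemma modified_bai_is_bai : is_bai product_order modified_bai.
Proof.
have [/tails_proper FI [Mb bM] bl br] := b_bai.
have [/tails_proper FN [Me eM] el er] := e_bai.
have FP := tails_proper product_order_directed.
have vp_cont : continuous (fun x => val (p x)).
  move=> x; apply: continuous_comp; first exact: projection_continuous.
  exact: subalgebra_val_continuous.
have vcont := @subalgebra_val_continuous J.
split; first exact: product_order_directed.
- have [C [C0 pC]] := continuous_linear_bounded (projection_linear p_proj)
    (projection_continuous p_proj).
  exists (Mb + C * Mb + Me) => -[i n]; rewrite /modified_bai /=.
  rewrite (le_trans (ler_normD _ _)) // lerD //; last exact: eM.
  rewrite (le_trans (ler_normB _ _)) // lerD // (le_trans (pC _)) //.
  by rewrite ler_wpM2l.
- move=> a.
  (* The factor [a] moves inside [p] in the second term, while [e x.2], lying in the ideal, only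
     sees [p a]. *)
  have -> : (fun x => modified_bai x ** a) = (fun x => b x.1 ** a
      - val (p (b x.1 ** a)) + val (e x.2 ** p a)).
    apply/funext => x; rewrite /modified_bai !bmulDl projection_mulr.
    by rewrite -scaleN1r bmulZl scaleN1r (projectionMr p_proj).
  have : (fun x => b x.1 ** a - val (p (b x.1 ** a)) + val (e x.2 ** p a))
      @ tails product_order --> a - val (p a) + val (p a);
    last by rewrite subrK.
  have ba : (fun x : I * nat => b x.1 ** a) @ tails product_order --> a.
    exact: cvg_comp tails_fst (bl a).
  apply: cvgD; first by apply: cvgB => //; exact: cvg_comp ba (vp_cont _).
  have : (fun x : I * nat => e x.2 ** p a) @ tails product_order --> p a.
    exact: cvg_comp tails_snd (el (p a)).
  by move=> /cvg_comp; apply; exact: vcont.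
- move=> a.
  have -> : (fun x => a ** modified_bai x) = (fun x => a ** b x.1
      - val (p (a ** b x.1)) + val (p a ** e x.2)).
    apply/funext => x; rewrite /modified_bai !bmulDr projection_mull.
    by rewrite -scaleN1r bmulZr scaleN1r (projectionMl p_proj).
  have : (fun x => a ** b x.1 - val (p (a ** b x.1)) + val (p a ** e x.2))
      @ tails product_order --> a - val (p a) + val (p a);
    last by rewrite subrK.
  have ba : (fun x : I * nat => a ** b x.1) @ tails product_order --> a.
    exact: cvg_comp tails_fst (br a).
  apply: cvgD; first by apply: cvgB => //; exact: cvg_comp ba (vp_cont _).
  have : (fun x : I * nat => p a ** e x.2) @ tails product_order --> p a.
    exact: cvg_comp tails_snd (er (p a)).
  by move=> /cvg_comp; apply; exact: vcont.
Qed.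

End IdealProjection.

(** * Multipliers *)

Section LocalMultipliers.
Variables (R : realType) (B : banachAlgType R[i]) (J : closed_subalgebra B).
Variable p : B -> subalgebra J.
Hypothesis J_ideal : two_sided_ideal J.
Hypothesis p_proj : bimodule_projection p.
Hypothesis J_wsc : weakly_sequentially_complete (subalgebra J).
Variable e : nat -> subalgebra J.
Hypothesis e_bai : is_bai (fun i j : nat => (i <= j)%N) e.
Variable nu : B -> B.
Hypothesis nu_cont : continuous nu.
Hypothesis nu_cauchy :
  forall g : tdual B, cauchy (g (nu (val (e n))) @[n --> \oo]).

Lemma tails_nat : tails (fun i j : nat => (i <= j)%N) = \oo.
Proof.
apply/seteqP; split=> P [n]; first by move=> Pn; exists n.
by move=> _ Pn; exists n => j nj; exact: Pn.
Qed.

Let bai_left_nat (x : subalgebra J) : e n ** x @[n --> \oo] --> x.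
Proof. by have := @bai_left _ _ _ _ _ e_bai x; rewrite tails_nat. Qed.

Let bai_right_nat (x : subalgebra J) : x ** e n @[n --> \oo] --> x.
Proof. by have := @bai_right _ _ _ _ _ e_bai x; rewrite tails_nat. Qed.

Fact projection_functional (f : tdual (subalgebra J)) :
  (fun x => f (p x)) \in @functional R B.
Proof.
apply/functionalP; split=> [k x y|x].
  by rewrite (projection_linear p_proj) linearP.
apply: continuous_comp; first exact: projection_continuous.
exact: dual_continuous.
Qed.

(** Applying [p] gives a sequence typed in [J], where weak sequential completeness applies; it is
    weakly Cauchy because [f] composed with [p] is a functional on [B]. *)
Lemma multiplier_weak_limit :
  exists c, weakly_cvg (fun n => p (nu (val (e n)))) c.
Proof.
by apply: J_wsc => f; exact: (nu_cauchy (Dual (projection_functional f))).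
Qed.

Let pnu_cvg (u : nat -> subalgebra J) (x : subalgebra J) :
  u @ \oo --> x -> (fun n => p (nu (val (u n)))) @ \oo --> p (nu (val x)).
Proof.
move=> ux; have cont : continuous (fun y : subalgebra J => p (nu (val y))).
  move=> y; apply: continuous_comp; last exact: projection_continuous.
  by apply: continuous_comp; [exact: subalgebra_val_continuous|exact: nu_cont].
exact: cvg_comp ux (cont x).
Qed.

Let nu_cvg (u : nat -> subalgebra J) (x : subalgebra J) :
  u @ \oo --> x -> (fun n => nu (val (u n))) @ \oo --> nu (val x).
Proof.
move=> ux; have cont : continuous (fun y : subalgebra J => nu (val y)).
  move=> y; apply: continuous_comp; last exact: nu_cont.
  exact: subalgebra_val_continuous.
exact: cvg_comp ux (cont x).
Qed.

(** As [J] is closed, [nu x] lies in it as the limit of the [nu (u n)]. It is used with [u n] equal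
    to [x ** e n] for left multipliers and [e n ** x] for right ones. *)
Let val_p_nu (u : nat -> subalgebra J) (x : subalgebra J) :
    u @ \oo --> x -> (forall n, subalgebra_set J (nu (val (u n)))) ->
  val (p (nu (val x))) = nu (val x).
Proof.
move=> ux Ju; apply: projection_ideal => //.
apply: (closed_cvg (subalgebra_set J) _ _ _ (nu_cvg ux)).
  exact: subalgebra_closed.
by apply: filterE.
Qed.

(** With [c] the weak limit of [p (nu (e n))], the sequence [p (nu (e n ** x)) = p (nu (e n)) ** x]
    tends in norm to [p (nu x) = nu x] and weakly to [c ** x]. *)
Lemma left_multiplier_local :
  (forall a b, nu (a ** b) = nu a ** b) -> is_left_mult_on J nu.
Proof.
move=> nuM; have [c cE] := multiplier_weak_limit; exists c => x.
rewrite -(val_p_nu (@bai_right_nat x)); last first.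
  by move=> n; rewrite nuM; have [] := J_ideal (nu (val x)) (subalgebraP (e n)).
rewrite -[RHS]/(val (c ** x)); congr val; apply: dual_separates => f.
have lim1 : (fun n => f (p (nu (val (e n ** x))))) @ \oo -->
    (f (p (nu (val x))) : R[i]^o).
  exact: dual_cvg (pnu_cvg (@bai_left_nat x)).
have lim2 : (fun n => f (p (nu (val (e n ** x))))) @ \oo -->
    (f (c ** x) : R[i]^o).
  rewrite (_ : (fun n => _) = (fun n => lact x f (p (nu (val (e n)))))).
    exact: cE (lact x f).
  apply/funext => n; rewrite nuM /=; congr (f _); apply: val_inj.
  by rewrite (projectionMr p_proj).
exact: cvg_unique lim1 lim2.
Qed.

Lemma right_multiplier_local :
  (forall a b, nu (a ** b) = a ** nu b) -> is_right_mult_on J nu.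
Proof.
move=> nuM; have [c cE] := multiplier_weak_limit; exists c => x.
rewrite -(val_p_nu (@bai_left_nat x)); last first.
  by move=> n; rewrite nuM; have [] := J_ideal (nu (val x)) (subalgebraP (e n)).
rewrite -[RHS]/(val (x ** c)); congr val; apply: dual_separates => f.
have lim1 : (fun n => f (p (nu (val (x ** e n))))) @ \oo -->
    (f (p (nu (val x))) : R[i]^o).
  exact: dual_cvg (pnu_cvg (@bai_right_nat x)).
have lim2 : (fun n => f (p (nu (val (x ** e n))))) @ \oo -->
    (f (x ** c) : R[i]^o).
  rewrite (_ : (fun n => _) = (fun n => ract f x (p (nu (val (e n)))))).
    exact: cE (ract f x).
  apply/funext => n; rewrite nuM /=; congr (f _); apply: val_inj.
  by rewrite (projectionMl p_proj).
exact: cvg_unique lim1 lim2.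
Qed.

End LocalMultipliers.

(** * From convergence along approximate identities to membership in the algebra *)

Section TypeM.
Variables (R : realType) (A : banachAlgType R[i]).

(** The trace on [mu] of the condition on mixed identities. Existence of limits, whatever their
    values, is what yields weak Cauchy sequences in the ideals. *)
Definition bai_convergent (mu : A -> A) : Prop :=
  forall (f : tdual A) (I : Type) (le : I -> I -> Prop) (e : I -> A),
    is_bai le e -> exists l : R[i]^o, f (mu (e i)) @[i --> tails le] --> l.

Section Restriction.
Variables (mu : A -> A) (S : closed_subalgebra A).
Hypothesis mu_linear : linear mu.
Hypothesis mu_cont : continuous mu.
Hypothesis mu_stable : forall x, subalgebra_set S x -> subalgebra_set S (mu x).

Fact subalgebra_restr_subproof (x : subalgebra S) :
  mu (val x) \in subalgebra_pred S.
Proof. by apply/asboolP/mu_stable/subalgebraP. Qed.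

Definition subalgebra_restr (x : subalgebra S) : subalgebra S :=
  Subalgebra (subalgebra_restr_subproof x).

Lemma subalgebra_restr_linear : linear subalgebra_restr.
Proof. by move=> k x y; apply: val_inj; rewrite /= mu_linear. Qed.

Lemma subalgebra_restr_continuous : continuous subalgebra_restr.
Proof.
have [M [_ muM]] := continuous_linear_bounded mu_linear mu_cont.
by apply: (@bounded_linear_continuous _ _ _ _ M) => [|x];
  [exact: subalgebra_restr_linear|exact: muM].
Qed.

Lemma subalgebra_restr_cauchy (J : closed_subalgebra (subalgebra S))
    (p : subalgebra S -> subalgebra J) (e : nat -> subalgebra J) :
    has_bai (subalgebra S) -> bai_extends S ->
    two_sided_ideal J -> bimodule_projection p ->
    is_bai (fun i j : nat => (i <= j)%N) e -> bai_convergent mu ->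
  forall g : tdual (subalgebra S),
    cauchy (g (subalgebra_restr (val (e n))) @[n --> \oo]).
Proof.
move=> [I [le [b b_bai]]] ext J_ideal p_proj e_bai mu_bai g.
(* Convergence is known for functionals on [A], hence the Hahn-Banach extension of [g]. *)
have [G <-] := dual_extend g.
have FF := tails_proper (product_order_directed b_bai).
have [l] := mu_bai G _ _ _
  (ext _ _ _ (modified_bai_is_bai J_ideal p_proj b_bai e_bai)).
move/cvgrPdist_lt => Gl; apply: cauchy_exP => d d0.
have [[i n0] near_l] := Gl _ d0.
pose y := b i - val (p (b i)).
(* Freezing the first index at [i], [G (mu y) + G (mu (e n))] stays within [d] of [l] for all
   [n >= n0]; this gives the centre of a ball of radius [d] containing a tail of the sequence. *)
exists (l - G (mu (val y))); exists n0 => // n n0n.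
rewrite /= -ball_normE /=.
have := near_l (i, n) (conj (directed_refl (bai_directed b_bai) i) n0n).
have muD a c : mu (a + c) = mu a + mu c.
  by have := mu_linear 1 a c; rewrite !scale1r.
have -> : val (modified_bai p b e (i, n)) = val y + val (val (e n)) by [].
by rewrite muD linearD opprD addrA.
Qed.

End Restriction.

(** Multiplication is obtained in three stages: on each ideal by the weak limit, on the subalgebra
    by (III), on [A] by (2). *)
Lemma type_LM_left_mult (mu : A -> A) : type_LM A -> left_multiplier mu ->
  bai_convergent mu -> is_left_mult mu.
Proof.
move=> [_ A_LM] mu_mult mu_bai; have [muL muc muM] := mu_mult.
have [S [I [J [S_bai J_fam S_local _ S_stable S_ext S_every]]]] :=
  A_LM mu mu_mult.
pose nu := subalgebra_restr S_stable.
have nuL : linear nu by exact: subalgebra_restr_linear.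
have nuc : continuous nu by exact: subalgebra_restr_continuous.
have nuM a b : nu (a ** b) = nu a ** b by apply: val_inj; rewrite /= muM.
apply: S_ext; have [|i|c cE] := S_local nu; first by [].
  have [e e_bai] := family_bai J_fam i.
  have [p p_proj] := family_projection J_fam i.
  have J_ideal : two_sided_ideal (J i) by exact: family_ideal.
  have J_wsc : weakly_sequentially_complete (subalgebra (J i)).
    exact: family_wsc.
  apply: (left_multiplier_local J_ideal p_proj J_wsc e_bai) => //.
  exact: (subalgebra_restr_cauchy muL S_stable S_bai S_every J_ideal p_proj
    e_bai).
by exists c => x; have /(congr1 val) := cE x.
Qed.

Lemma type_RM_right_mult (mu : A -> A) : type_RM A -> right_multiplier mu ->
  bai_convergent mu -> is_right_mult mu.
Proof.
move=> [_ A_RM] mu_mult mu_bai; have [muL muc muM] := mu_mult.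
have [S [I [J [S_bai J_fam S_local _ S_stable S_ext S_every]]]] :=
  A_RM mu mu_mult.
pose nu := subalgebra_restr S_stable.
have nuL : linear nu by exact: subalgebra_restr_linear.
have nuc : continuous nu by exact: subalgebra_restr_continuous.
have nuM a b : nu (a ** b) = a ** nu b by apply: val_inj; rewrite /= muM.
apply: S_ext; have [|i|c cE] := S_local nu; first by [].
  have [e e_bai] := family_bai J_fam i.
  have [p p_proj] := family_projection J_fam i.
  have J_ideal : two_sided_ideal (J i) by exact: family_ideal.
  have J_wsc : weakly_sequentially_complete (subalgebra (J i)).
    exact: family_wsc.
  apply: (right_multiplier_local J_ideal p_proj J_wsc e_bai) => //.
  exact: (subalgebra_restr_cauchy muL S_stable S_bai S_every J_ideal p_proj
    e_bai).
by exists c => x; have /(congr1 val) := cE x.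
Qed.

Implicit Types m E : tdual (tdual A).

(** The hypothesis on [E] reads [E (bidual_ract f m) = m f]. All mixed identities thus agree at [f]
    composed with [mu], which makes [mu] convergent along every approximate identity. *)
Lemma type_LM_in_algebra m : type_LM A ->
    (forall a, exists b, arensl m (bidual_inj a) = bidual_inj b) ->
    (forall E, mixed_identity E -> arensr m E = m) ->
  exists a, m = bidual_inj a.
Proof.
move=> A_LM mA mE; have [[I [le [e e_bai]]] _] := A_LM.
have [mu [mu_mult fmu]] := arensl_left_multiplier mA.
have mfE f E : mixed_identity E -> E (bidual_ract f m) = m f.
  by move=> /mE {2}<-.
have [|a muE] := type_LM_left_mult A_LM mu_mult.
  move=> f K leK u u_bai; exists (m f).
  rewrite (_ : (fun i => _) = (fun i => bidual_ract f m (u i))).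
    by apply: bai_cvg_of_mixed_identity => // E; exact: mfE.
  by apply/funext => i; rewrite /= fmu.
(* Now [bidual_ract f m] is [f . a], so a single mixed identity suffices:
   [m f = E (f . a) = (a . E) f = f a]. *)
exists a; apply: dualP => f; have [E EE] := has_mixed_identity e_bai.
rewrite -(mfE f E EE) (_ : bidual_ract f m = ract f a).
  by have [/(congr1 (fun n : tdual (tdual A) => n f))] := EE (bidual_inj a).
by apply: dualP => b; rewrite /= fmu muE.
Qed.

Lemma type_RM_in_algebra m : type_RM A ->
    (forall a, exists b, arensl (bidual_inj a) m = bidual_inj b) ->
    (forall E, mixed_identity E -> arensl E m = m) ->
  exists a, m = bidual_inj a.
Proof.
move=> A_RM mA mE; have [[I [le [e e_bai]]] _] := A_RM.
have [mu [mu_mult fmu]] := arensl_right_multiplier mA.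
have mfE f E : mixed_identity E -> E (bidual_lact m f) = m f.
  by move=> /mE {2}<-.
have [|a muE] := type_RM_right_mult A_RM mu_mult.
  move=> f K leK u u_bai; exists (m f).
  rewrite (_ : (fun i => _) = (fun i => bidual_lact m f (u i))).
    by apply: bai_cvg_of_mixed_identity => // E; exact: mfE.
  by apply/funext => i; rewrite /= fmu.
exists a; apply: dualP => f; have [E EE] := has_mixed_identity e_bai.
rewrite -(mfE f E EE) (_ : bidual_lact m f = lact a f).
  by have [_ /(congr1 (fun n : tdual (tdual A) => n f))] := EE (bidual_inj a).
by apply: dualP => b; rewrite /= fmu muE.
Qed.

End TypeM.

Theorem corollary28 (R : realType) (A : banachAlgType R[i]) (m : tdual (tdual A)) :
  type_M A ->
  [<-> exists a : A, m = bidual_inj a;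
       (forall a : A, exists b : A, arensl m (bidual_inj a) = bidual_inj b) /\
         left_centre m;
       (forall a : A, exists b : A, arensl m (bidual_inj a) = bidual_inj b) /\
         (forall E, mixed_identity E -> arensr m E = m);
       (forall a : A, exists b : A, arensl (bidual_inj a) m = bidual_inj b) /\
         (forall E, mixed_identity E -> arensl E m = m);
       (forall a : A, exists b : A, arensl (bidual_inj a) m = bidual_inj b) /\
         right_centre m].
Proof.
move=> [A_LM A_RM].
have injM (a b : A) :
    arensl (bidual_inj a) (bidual_inj b) = bidual_inj (a ** b).
  exact: dualP.
have centrel E : left_centre m -> mixed_identity E -> arensr m E = m.
  by move=> cm EE; rewrite -left_centre_arens //; have [] := EE m.
have centrer E : right_centre m -> mixed_identity E -> arensl E m = m.
  by move=> cm EE; rewrite -right_centre_arens //; have [] := EE m.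
(* The implications form a cycle. Type (LM^+) serves in (iii) to (iv), by first putting [m] in [A];
   type (RM^+) serves in (iv) to (v) and in (v) to (i). *)
tfae.
- move=> [a ->]; split; last exact: left_centre_inj.
  by move=> b; exists (a ** b).
- by move=> [mA cm]; split=> // E; exact: centrel.
- move=> [mA mE]; have [a mEa] := type_LM_in_algebra A_LM mA mE.
  split=> [b|E]; last by apply: centrer; rewrite mEa; exact: right_centre_inj.
  by exists (b ** a); rewrite mEa.
- move=> [mA mE]; have [a ->] := type_RM_in_algebra A_RM mA mE.
  split; last exact: right_centre_inj.
  by move=> b; exists (b ** a).
- move=> [mA cm]; apply: type_RM_in_algebra => // E; exact: centrer.
Qed.
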